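(* Let $X$ be a metric space, let $\{\nu_n\}_{n=1}^\infty$ be a sequence of finite Borel measures on $X$ and let $\nu$ be a finite Borel measure on $X$. Then the following conditions are equivalent to each other. (I) $\nu_n$ converges in total variation to $\nu$ as $n\to\infty$. (II) $\lim_{n\to\infty}\sup_{A}|\nu_n(A)-\nu(A)|=0$, the supremum being over all closed and bounded sets $A\subset X$. (III) $\lim_{n\to\infty}\sup_{B}|\nu_n(B)-\nu(B)|=0$, the supremum being over all open and bounded sets $B\subset X$. (IV) For any $\gamma\ge 0$, $\lim_{n\to\infty}\sup_{f\in M_\gamma(X)}\left|\int_X f\,d\nu_n-\int_X f\,d\nu\right|=0$. (V) For any $\gamma\ge 0$, $\lim_{n\to\infty}\sup_{f}\left|\int_X f\,d\nu_n-\int_X f\,d\nu\right|=0$, the supremum being over all $f\in M_\gamma(X)$ with bounded support. (VI) For any $\gamma\ge 0$, $\lim_{n\to\infty}\sup_{f}\left|\int_X f\,d\nu_n-\int_X f\,d\nu\right|=0$, the supremum being over all $f\in C(X)\cap M_\gamma(X)$ with bounded support. (VII) For any $\gamma\ge 0$, $\lim_{n\to\infty}\sup_{f}\left|\int_X f\,d\nu_n-\int_X f\,d\nu\right|=0$, the supremum being over all uniformly continuous $f\in C(X)\cap M_\gamma(X)$.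
   Context: $C(X)$ is the set of continuous functions $X\to\mathbb{R}$. For $\gamma\ge 0$, $M_\gamma(X)$ is the set of Borel measurable functions $X\to[-\gamma,\gamma]$. The support of $f:X\to\mathbb{R}$ is the closure of $\{x: f(x)\ne 0\}$. The sequence $\nu_n$ converges in total variation to $\nu$ if $\lim_{n\to\infty}\sup_{f\in M_1(X)}\left|\int_X f\,d\nu_n-\int_X f\,d\nu\right|=0$. *)

(* Defs.v *)
From HB Require Import structures.
From mathcomp Require Import all_boot all_order all_algebra.
From mathcomp Require Import all_classical all_reals all_analysis.

Set Implicit Arguments.
Unset Strict Implicit.
Unset Printing Implicit Defensive.

Import Order.TTheory GRing.Theory Num.Theory.
Import numFieldNormedType.Exports.

Local Open Scope classical_set_scope.
Local Open Scope ring_scope.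

(* Every measurableType is pointed, so the Borel sigma-algebra can only be put
   on a nonempty metric space; the base point plays no other role. *)
#[short(type="pmetricType")]
HB.structure Definition PointedMetric (K : numDomainType) :=
  { M of Metric K M & Pointed M }.

Notation borel X := (g_sigma_algebraType (@open X)).

Notation borel_finite_measure R X :=
  {finite_measure set (borel X) -> \bar R}.

Definition metric_bounded (R : realType) (X : metricType R) (A : set X) :=
  exists (x : X) (r : R), A `<=` ball x r.

Definition M_ (R : realType) (X : pmetricType R) (gamma : R) : set (X -> R) :=
  [set f | measurable_fun [set: borel X] (f : borel X -> R) /\
           forall x, f x \in `[- gamma, gamma]].

Arguments M_ {R} X gamma.

Definition tsupport (R : realType) (X : topologicalType) (f : X -> R) : set X :=
  closure [set x | f x != 0].

(* The suprema are taken in \bar R. The values are finite (finite measures,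
   bounded measurable functions), and the families used below are nonempty, so
   the value -oo of ereal_sup on the empty set does not occur. *)

Definition sup_measure_cvg0 (R : realType) (X : pmetricType R)
    (nu_ : nat -> borel_finite_measure R X) (nu : borel_finite_measure R X)
    (S : set (set X)) :=
  ereal_sup [set `|nu_ n A - nu A|%E | A in S] @[n --> \oo] --> 0%E.

Definition sup_integral_cvg0 (R : realType) (X : pmetricType R)
    (nu_ : nat -> borel_finite_measure R X) (nu : borel_finite_measure R X)
    (F : set (X -> R)) :=
  ereal_sup [set `|\int[nu_ n]_x (f x)%:E - \int[nu]_x (f x)%:E|%E | f in F]
    @[n --> \oo] --> 0%E.

Definition cvg_total_variation (R : realType) (X : pmetricType R)
    (nu_ : nat -> borel_finite_measure R X) (nu : borel_finite_measure R X) :=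
  sup_integral_cvg0 nu_ nu (M_ X 1).

(* Main.v *)
Require Import Defs.
From HB Require Import structures.
From mathcomp Require Import all_boot all_order all_algebra.
From mathcomp Require Import all_classical all_reals all_analysis.
From mathcomp Require Import measurable_realfun lra zify.

Set Implicit Arguments.
Unset Strict Implicit.
Unset Printing Implicit Defensive.

Import Order.TTheory GRing.Theory Num.Theory.
Import numFieldNormedType.Exports.

Local Open Scope classical_set_scope.
Local Open Scope ring_scope.

(* For a fixed n, each of the seven suprema controls the next one up to a
   constant independent of n.  From sets to functions: a bound on
   |nu_n(U) - nu(U)| for bounded open U passes to all open sets by continuity
   along increasing unions, to all Borel sets by outer regularity of finite
   Borel measures on a metric space, and to integrals of functions with values
   in [0, 1] by approximating them by averages of indicators of superlevel
   sets; an affine change of variables handles [-gamma, gamma].  An open set U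
   is the increasing union of the closed sets {x | d(x, X \ U) >= 1/k}, and its
   indicator is the limit of the Lipschitz functions min(1, k d(x, X \ U)).
   Bounded support is removed by multiplying with Lipschitz cutoffs and using
   dominated convergence. *)

(** * Lipschitz functions: truncation to [0, 1] and the capped distance to a set *)

Section lipschitz.
Context {R : realType} {X : metricType R}.
Implicit Types (f : X -> R) (k : R) (A : set X) (x y : X).

Definition mlipschitz k f := forall x y, `|f x - f y| <= k * mdist x y.

Lemma mlipschitz_unif_continuous k f : mlipschitz k f -> unif_continuous f.
Proof.
move=> fk; apply/unif_continuousP => e e0.
have k1 : 0 < `|k| + 1 by rewrite ltr_wpDl.
exists (e / (`|k| + 1)); first by rewrite divr_gt0.
move=> [x y]/=; rewrite !ballEmdist/= ltr_pdivlMr// => xy.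
apply: le_lt_trans xy; rewrite mulrC.
apply: (le_trans (fk _ _)); rewrite ler_wpM2r ?mdist_ge0//.
by rewrite (le_trans (ler_norm k))// lerDl.
Qed.

Lemma mlipschitz_continuous k f : mlipschitz k f -> continuous f.
Proof.
move=> /mlipschitz_unif_continuous/unif_continuousP fu x.
apply/cvgrPdist_lt => e e0; have [d d0 fd] := fu _ e0.
have := nbhsx_ballx x d d0; apply: filterS => y xy.
exact: (fd (x, y)).
Qed.

Lemma mlipschitz_mdist (a : X) : mlipschitz 1 (mdist a).
Proof.
move=> x y; rewrite mul1r ler_norml; apply/andP; split.
  by have := metric_triangle a x y; lra.
by have := metric_triangle a y x; rewrite (metric_sym y x); lra.
Qed.

Definition clamp (t : R) : R := Num.max 0 (Num.min 1 t).

Lemma clamp_ge0 t : 0 <= clamp t.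
Proof. by rewrite le_max lexx. Qed.

Lemma clamp_le1 t : clamp t <= 1.
Proof. by rewrite ge_max ler01 ge_min lexx. Qed.

Lemma clamp_id_le0 t : t <= 0 -> clamp t = 0.
Proof.
by move=> t0; rewrite /clamp; apply/max_idPl; rewrite ge_min t0 orbT.
Qed.

Lemma clamp_id_ge1 t : 1 <= t -> clamp t = 1.
Proof. by move=> t1; rewrite /clamp min_l// max_r. Qed.

Lemma clamp_lip s t : `|clamp s - clamp t| <= `|s - t|.
Proof.
rewrite /clamp /Num.max /Num.min ler_norml.
have [?|?] := ltP 1 s; have [?|?] := ltP 1 t;
  do ![case: ifPn; rewrite -?leNgt => ?];
  case: (ler0P (s - t)) => ?; apply/andP; split; lra.
Qed.

Lemma mlipschitz_clamp k f : mlipschitz k f -> mlipschitz k (clamp \o f).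
Proof. by move=> kf x y; apply: le_trans (kf x y); exact: clamp_lip. Qed.

(* Capping at 1 keeps the set under the infimum nonempty when A is empty,
   so that cdist set0 = 1 rather than the junk value inf set0 = 0. *)
Definition cdist (A : set X) (x : X) : R :=
  inf ([set mdist x y | y in A] `|` [set 1]).

Lemma cdist_has_lbound A x :
  has_lbound ([set mdist x y | y in A] `|` [set 1]).
Proof.
by exists 0 => _ [[y _ <-]|->]//; exact: mdist_ge0.
Qed.

Lemma cdist_ge0 A x : 0 <= cdist A x.
Proof.
apply: lb_le_inf; first by exists 1; right.
by move=> _ [[y _ <-]|->]//; exact: mdist_ge0.
Qed.

Lemma cdist_eq0 A x : A x -> cdist A x = 0.
Proof.
move=> Ax; apply/eqP; rewrite eq_le cdist_ge0 andbT.
apply: ge_inf; first exact: cdist_has_lbound.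
by left; exists x => //; exact: mdistxx.
Qed.

Lemma cdist_gt0 A x : closed A -> ~ A x -> 0 < cdist A x.
Proof.
move=> cA nAx; have : nbhs x (~` A).
  by apply: open_nbhs_nbhs; split => //; exact: closed_openC.
rewrite -nbhs_ballE => -[e /= e0 xeA].
(* [e] bounds the distances to points of [A] from below, and 1 is the cap in the infimum. *)
apply: (@lt_le_trans _ _ (Num.min e 1)); first by rewrite lt_min e0/=.
apply: lb_le_inf; first by exists 1; right.
move=> _ [[y Ay <-]|->]; last by rewrite ge_min lexx orbT.
rewrite ge_min leNgt; apply/orP; left; apply/negP => xy.
by apply: (xeA y) => //; rewrite ballEmdist.
Qed.

Lemma mlipschitz_cdist A : mlipschitz 1 (cdist A).
Proof.
(* Exchanging [x] and [y] in this one-sided estimate gives the other side. *)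
have le1 x y : cdist A x - cdist A y <= mdist x y.
  rewrite lerBlDr -lerBlDl; apply: lb_le_inf; first by exists 1; right.
  move=> _ [[z Az <-]|->]; rewrite lerBlDl.
    apply: le_trans (metric_triangle x y z).
    by apply: ge_inf; [exact: cdist_has_lbound|left; exists z].
  apply: (@le_trans _ _ 1); last by rewrite lerDr mdist_ge0.
  by apply: ge_inf; [exact: cdist_has_lbound|right].
move=> x y; rewrite mul1r ler_norml le1 andbT lerNl opprB.
by rewrite metric_sym le1.
Qed.

End lipschitz.

(** * Borel sets and outer regularity of finite Borel measures *)

Section borel.
Context {R : realType} {X : pmetricType R}.
Implicit Types (A U F : set X) (f : X -> R) (mu : borel_finite_measure R X).

Lemma open_borel U : open U -> measurable (U : set (borel X)).
Proof. by move=> oU; exact: sub_sigma_algebra. Qed.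

Lemma closed_borel F : closed F -> measurable (F : set (borel X)).
Proof.
move=> cF; rewrite -[F]setCK; apply: measurableC; apply: open_borel.
exact: closed_openC.
Qed.

Lemma continuous_borel f : continuous f ->
  measurable_fun [set: borel X] (f : borel X -> R).
Proof.
move=> /continuousP cf; apply: (measurability _ (RGenOpens.measurableE R)).
move=> _ [_ [a [b ->] <-]]; rewrite setTI; apply: open_borel.
exact/cf/interval_open.
Qed.

(** Stated through the excess of [U] over [A], which subadditivity can estimate, rather than through
    an infimum of measures of open sets. *)
Definition outer_regular mu A := forall e : R, 0 < e ->
  exists U, [/\ open U, A `<=` U & (mu (U `\` A) <= e%:E)%E].

Lemma outer_regular_open mu U : open U -> outer_regular mu U.
Proof.
by move=> oU e e0; exists U; split; rewrite // setDv measure0 lee_fin ltW.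
Qed.

(** Continuity from above at the empty set: the differences decrease to [set0], and [mu] is
    finite. *)
Lemma small_tail mu (A : (set X)^nat) (e : R) : 0 < e ->
  (forall n, measurable (A n : set (borel X))) -> nonincreasing_seq A ->
  exists n, (mu (A n `\` \bigcap_k A k) <= e%:E)%E.
Proof.
move=> e0 mA niA.
have mI : measurable (\bigcap_k A k : set (borel X)).
  exact: bigcap_measurableType.
pose B n : set (borel X) := A n `\` \bigcap_k A k.
have mB n : measurable (B n) by exact: measurableD.
have B0 : \bigcap_n B n = set0.
  apply/seteqP; split => // x Bx; case: (Bx 0%N I) => _; apply=> n _.
  by case: (Bx n I).
have := @nonincreasing_cvg_mu _ (borel X) R mu B.
rewrite B0 measure0 -ge0_fin_numE// fin_num_measure//.
move=> /(_ isT mB measurable0).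
have niB : nonincreasing_seq B.
  by move=> m n mn; rewrite subsetEset; apply: setSD; exact/subsetPset/niA.
move=> /(_ niB) /fine_cvgP[_ /cvgrPdist_le /(_ _ e0)[N _ /(_ N (leqnn _))]]/=.
rewrite sub0r normrN => /(le_trans (ler_norm _)) BN; exists N.
by rewrite -[leLHS]fineK ?lee_fin//; exact: fin_num_measure (mB N).
Qed.

(** [F] is the decreasing intersection of the open sets where [cdist F] is below 1/(n+1), so one of
    them has small excess. *)
Lemma outer_regular_closed mu F : closed F -> outer_regular mu F.
Proof.
move=> cF e e0; pose A n := [set x | cdist F x < n.+1%:R^-1].
have oA n : open (A n).
  have /continuousP := mlipschitz_continuous (mlipschitz_cdist F).
  by move=> /(_ [set t | t < n.+1%:R^-1]); apply; exact: open_lt.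
have niA : nonincreasing_seq A.
  move=> m n mn; apply/subsetPset => x /lt_le_trans; apply.
  by rewrite lef_pV2 ?posrE// ler_nat.
have [||n] := @small_tail mu A e e0 => //; first by move=> m; exact: open_borel.
have -> : \bigcap_k A k = F.
  apply/seteqP; split => x; last by move=> Fx m _; rewrite /A/= cdist_eq0.
  move=> Ax; apply: contrapT => /(cdist_gt0 cF) /[dup] d0.
  (* With d = [cdist F x] and n the integer part of 1/d, 1/(n+1) < d, so [x] lies outside [A n]. *)
  rewrite -invr_gt0 => di; have := Ax (Num.trunc (cdist F x)^-1) I.
  rewrite /A/= ltNge => /negP; apply; rewrite invf_ple ?posrE//.
  by rewrite ltW// truncnS_gt.
by move=> An; exists (A n); split => // x Fx; rewrite /A/= cdist_eq0.
Qed.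

(** The excess of the union of the [U n] lies in the union of the excesses, and the errors e/2^(n+1)
    sum to e. *)
Lemma outer_regular_bigcup mu (A : (set X)^nat) :
  (forall n, measurable (A n : set (borel X))) ->
  (forall n, outer_regular mu (A n)) -> outer_regular mu (\bigcup_n A n).
Proof.
move=> mA rA e e0.
have /choice[U UP] n : exists U, [/\ open U, A n `<=` U &
    (mu (U `\` A n) <= (e / (2 ^ n.+1)%:R)%:E)%E].
  by apply: rA; rewrite divr_gt0// ltr0n expn_gt0.
have oU n : open (U n) by case: (UP n).
exists (\bigcup_n U n); split; first exact: bigcup_open.
  by apply: subset_bigcup => n _; case: (UP n).
have mUA n : measurable (U n `\` A n : set (borel X)).
  by apply: measurableD => //; exact: open_borel.
apply: (@le_trans _ _ (\sum_(0 <= n <oo) mu (U n `\` A n))%E).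
  apply: measure_sigma_subadditive => //.
    apply: measurableD; last exact: bigcup_measurable.
    by apply: bigcup_measurable => n _; exact: open_borel.
  move=> x [[n _ Unx] nAx]; exists n => //; split => // Anx.
  by apply: nAx; exists n.
apply: (@le_trans _ _ (\sum_(0 <= n <oo) (e / (2 ^ n.+1)%:R)%:E)%E).
  by apply: lee_nneseries => // n _; case: (UP n).
exact: epsilon_trick0 (ltW e0).
Qed.

(** The excess of the intersection of [U] and [V] lies in the union of the two excesses, each of
    measure at most e/2. *)
Lemma outer_regularI mu A B :
  measurable (A : set (borel X)) -> measurable (B : set (borel X)) ->
  outer_regular mu A -> outer_regular mu B -> outer_regular mu (A `&` B).
Proof.
move=> mA mB rA rB e e0; have e20 : 0 < e / 2 by rewrite divr_gt0.
have [U [oU AU Ue]] := rA _ e20; have [V [oV BV Ve]] := rB _ e20.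
have mUA : measurable (U `\` A : set (borel X)).
  by apply: measurableD => //; exact: open_borel.
have mVB : measurable (V `\` B : set (borel X)).
  by apply: measurableD => //; exact: open_borel.
exists (U `&` V); split; [exact: openI|exact: setISS|].
rewrite (splitr e) EFinD; apply: le_trans (leeD Ue Ve).
apply: le_trans (measureU2 mu mUA mVB).
apply: le_measure; rewrite ?inE//.
- apply: measurableD; last exact: measurableI.
  by apply: measurableI; exact: open_borel.
- exact: measurableU.
- move=> x [[Ux Vx] nABx]; have [Ax|] := pselect (A x); last by left.
  by right; split => // Bx; apply: nABx.
Qed.

Lemma outer_regular_bigcap_lt mu (A : (set X)^nat) n :
  (forall n, measurable (A n : set (borel X))) ->
  (forall n, outer_regular mu (A n)) ->
  outer_regular mu (\bigcap_(k < n) A k).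
Proof.
move=> mA rA; elim: n => [|n ih].
  by rewrite bigcap_mkord big_ord0; apply: outer_regular_open; exact: openT.
rewrite bigcap_mkord big_ord_recr/= -bigcap_mkord.
by apply: outer_regularI => //; exact: bigcap_measurableType.
Qed.

(** A countable intersection of open sets need not be open. Instead, a finite partial intersection
    [B n] comes within e/2 of the full one, and an open set around [B n] costs another e/2. *)
Lemma outer_regular_bigcap mu (A : (set X)^nat) :
  (forall n, measurable (A n : set (borel X))) ->
  (forall n, outer_regular mu (A n)) -> outer_regular mu (\bigcap_n A n).
Proof.
move=> mA rA e e0; have e20 : 0 < e / 2 by rewrite divr_gt0.
pose B n := \bigcap_(k < n) A k.
have mB n : measurable (B n : set (borel X)) by exact: bigcap_measurableType.
have niB : nonincreasing_seq B.
  move=> m n mn; apply/subsetPset => x Bx k /= km; apply: Bx => /=.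
  exact: leq_trans mn.
have BA : \bigcap_n B n = \bigcap_n A n.
  apply/seteqP; split => x Hx n _; last by move=> k _; exact: Hx.
  by apply: (Hx n.+1 I) => /=.
have [n] := small_tail mu e20 mB niB; rewrite BA => Bn.
have [U [oU BU Ue]] := outer_regular_bigcap_lt n mA rA e20.
have mI : measurable (\bigcap_k A k : set (borel X)).
  exact: bigcap_measurableType.
exists U; split => //; first by apply: subset_trans BU => x Ax k _; exact: Ax.
have mU := open_borel oU.
rewrite (splitr e) EFinD; apply: le_trans (leeD Ue Bn).
apply: le_trans (measureU2 mu (measurableD mU (mB n)) (measurableD (mB n) mI)).
apply: le_measure; rewrite ?inE; [exact: measurableD| |].
  by apply: measurableU; exact: measurableD.
move=> x [Ux nAx]; have [Bx|] := pselect (B n x); last by left.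
by right; split.
Qed.

Lemma borel_outer_regular mu A :
  measurable (A : set (borel X)) -> outer_regular mu A.
Proof.
(* Outer regularity alone is not visibly stable under complement. *)
move=> mA; pose G A := [/\ measurable (A : set (borel X)),
  outer_regular mu A & outer_regular mu (~` A)].
suff: G A by case.
have : sigma_algebra setT G.
  split.
  - split => //; first by apply: outer_regular_open; exact: open0.
    by rewrite setC0; apply: outer_regular_open; exact: openT.
  - move=> B [mB rB rCB]; rewrite setTD; split; [exact: measurableC|by []|].
    by rewrite setCK.
  - move=> B GB; split.
    + by apply: bigcup_measurable => n _; case: (GB n).
    + by apply: outer_regular_bigcup => n; case: (GB n).
    + rewrite setC_bigcup.
      apply: outer_regular_bigcap => n; last by case: (GB n).
      by apply: measurableC; case: (GB n).
move=> /smallest_sub; apply; last exact: mA.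
move=> U oU; split; [exact: open_borel|exact: outer_regular_open|].
by apply: outer_regular_closed; exact: open_closedC.
Qed.
End borel.

(** * Differences of two finite measures: limits, and passage from sets to functions *)

Section finite_measure_difference.
Context d (T : measurableType d) (R : realType).
Variables mu nu : {finite_measure set T -> \bar R}.
Local Open Scope ereal_scope.

Lemma bounded_integrable (mu0 : {finite_measure set T -> \bar R}) (f : T -> R)
    (c : R) :
  measurable_fun setT f -> (forall x, `|f x| <= c)%R ->
  mu0.-integrable setT (EFin \o f).
Proof.
move=> mf fc; apply: measurable_bounded_integrable => //.
  by rewrite -ge0_fin_numE// fin_num_measure.
exists c; split; first exact: num_real.
by move=> M cM x _ /=; exact: le_trans (ltW cM).
Qed.

(** Continuity from below under both measures, whose finiteness keeps the difference continuous. *)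
Lemma measure_diff_bigcup_le (F : (set T)^nat) (s : \bar R) :
  (forall n, measurable (F n)) -> nondecreasing_seq F ->
  (forall n, `|mu (F n) - nu (F n)| <= s) ->
  `|mu (\bigcup_n F n) - nu (\bigcup_n F n)| <= s.
Proof.
move=> mF ndF Fs; have mU := bigcup_measurable (fun k _ => mF k).
apply: (cvge_le (F := \oo)); first by near=> n; exact: Fs.
apply: cvg_abse; apply: cvgeB; last 2 first.
- exact: nondecreasing_cvg_mu.
- exact: nondecreasing_cvg_mu.
- by rewrite fin_num_adde_defr// fin_num_measure.
Unshelve. all: by end_near. Qed.

(** Dominated convergence under each measure, the constant [c] being integrable because the measures
    are finite. *)
Lemma integral_diff_cvg_le (f_ : (T -> R)^nat) (f : T -> R) (c : R)
    (s : \bar R) :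
  (forall n, measurable_fun setT (f_ n)) -> (forall n x, `|f_ n x| <= c)%R ->
  (forall x, f_ ^~ x @ \oo --> f x) ->
  (forall n, `|\int[mu]_x (f_ n x)%:E - \int[nu]_x (f_ n x)%:E| <= s) ->
  `|\int[mu]_x (f x)%:E - \int[nu]_x (f x)%:E| <= s.
Proof.
move=> mf fc ff fs.
have mfl : measurable_fun setT f.
  by apply: (measurable_fun_cvg (h := f_)) => // x _; exact: ff.
have flc x : (`|f x| <= c)%R.
  by apply: (cvgr_to_le (cvg_norm (ff x))); exact: nearW.
have cvgI (mu0 : {finite_measure set T -> \bar R}) :
    \int[mu0]_x (f_ n x)%:E @[n --> \oo] --> \int[mu0]_x (f x)%:E.
  apply: (@dominated_cvg _ _ _ mu0 setT measurableT (fun n => EFin \o f_ n)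
    (EFin \o f) (cst c%:E)) => //.
  - by move=> n; exact/measurable_EFinP.
  - by move=> x _; apply: cvg_EFin; [exact: nearW|exact: ff].
  - exact: finite_measure_integrable_cst.
  - by move=> n x _ /=; rewrite lee_fin.
apply: (cvge_le (F := \oo)); first by near=> n; exact: fs.
apply: cvg_abse; apply: cvgeB; [|exact: cvgI|exact: cvgI].
apply: fin_num_adde_defr; apply: integrable_fin_num => //.
exact: bounded_integrable mfl flc.
Unshelve. all: by end_near. Qed.

(** Identifies a layer cake sum over [M] levels with an integer part. *)
Lemma sum_ltn (M k : nat) : (\sum_(i < M) (i < k) = minn k M)%N.
Proof.
elim: M => [|M ih]; first by rewrite big_ord0 minn0.
by rewrite big_ord_recr/= ih; lia.
Qed.

Lemma integral01_diff_le (h : T -> R) (s : R) :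
  (forall A, measurable A -> `|mu A - nu A| <= s%:E) ->
  measurable_fun setT h -> (forall x, 0 <= h x <= 1)%R ->
  (`|\int[mu]_x h x - \int[nu]_x h x| <= s)%R.
Proof.
move=> mus mh h01; apply/ler_addgt0Pr => e e0.
(* Layer cake: with M levels, M h is within 1 of the number g M of the
   superlevel sets A i that contain the point. *)
pose K := (fine (mu setT) + fine (nu setT))%R.
(* [K] bounds the rounding error for the integrals of M h, and M > K/e makes it at most e after
   division by [M]. *)
pose M := (Num.trunc (K / e)).+1.
have M0 : (0 < M%:R :> R)%R by rewrite ltr0n.
(* The threshold i+1 makes the number of levels at a point the integer part of M h. *)
pose A i := [set x | (i.+1%:R <= M%:R * h x)%R].
have mA i : measurable (A i).
  rewrite -[A i]setTI; apply: measurable_fun_le => //.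
  exact: measurable_funM.
pose g N x : R := (\sum_(i < N) \1_(A i) x)%R.
have intg (mu0 : {finite_measure set T -> \bar R}) N :
    mu0.-integrable setT (EFin \o g N).
  rewrite (_ : EFin \o g N = fun x => \sum_(i < N) (\1_(A i) x)%:E); last first.
    by apply/funext => x /=; rewrite sumEFin.
  by apply: integrable_sum => // i _; exact: integrable_indic.
have gs N : (`|\int[mu]_x g N x - \int[nu]_x g N x| <= N%:R * s)%R.
  elim: N => [|N ih].
    rewrite mul0r /g; under eq_Rintegral do rewrite big_ord0.
    under [X in (_ - X)%R]eq_Rintegral do rewrite big_ord0.
    by rewrite !Rintegral_cst// !mul0r subrr normr0.
  have gS (mu0 : {finite_measure set T -> \bar R}) :
      (\int[mu0]_x g N.+1 x = \int[mu0]_x g N x + fine (mu0 (A N)))%R.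
    rewrite /g; under eq_Rintegral do rewrite big_ord_recr/=.
    rewrite RintegralD//; [|exact: intg|exact: integrable_indic].
    by rewrite [X in (_ + X)%R]/Rintegral integral_indic// setIT.
  have := mus _ (mA N).
  rewrite -(fineK (fin_num_measure mu _ (mA N))).
  rewrite -(fineK (fin_num_measure nu _ (mA N))) -EFinB abse_EFin lee_fin => AN.
  rewrite !gS -natr1 mulrDl mul1r opprD addrACA.
  by apply: le_trans (ler_normD _ _) (lerD _ _).
have hg x : (M%:R * h x - 1 <= g M x <= M%:R * h x)%R.
  have /andP[h0 h1] := h01 x.
  have Mh0 : (0 <= M%:R * h x)%R by rewrite mulr_ge0.
  have -> : g M x = (Num.trunc (M%:R * h x))%:R.
    (* Since h <= 1, the first [M] levels contain every level that [x] reaches. *)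
    rewrite /g; have tM : (Num.trunc (M%:R * h x) <= M)%N.
      rewrite -(ler_nat R); apply: (@le_trans _ _ (M%:R * h x)%R).
        by rewrite truncn_le.
      by rewrite ler_piMr.
    rewrite -[in RHS](minn_idPl tM) -sum_ltn natr_sum; apply: eq_bigr => i _.
    by rewrite indicE truncn_gt_nat; congr (nat_of_bool _)%:R; rewrite mem_setE.
  have /andP[] := truncn_itv Mh0.
  by rewrite -natr1; lra.
have inth (mu0 : {finite_measure set T -> \bar R}) :
    mu0.-integrable setT (EFin \o h).
  apply: (@bounded_integrable mu0 h 1) => // x.
  by have /andP[h0 h1] := h01 x; rewrite ger0_norm.
have err (mu0 : {finite_measure set T -> \bar R}) :
  (M%:R * \int[mu0]_x h x - fine (mu0 setT) <= \int[mu0]_x g M x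
    <= M%:R * \int[mu0]_x h x)%R.
  have iMh : mu0.-integrable setT (EFin \o (fun x => M%:R * h x)%R).
    exact: (integrableZl measurableT M%:R (inth mu0)).
  have i1 : mu0.-integrable setT (EFin \o cst 1%R).
    exact: finite_measure_integrable_cst.
  have iG := intg mu0 M.
  rewrite -RintegralZl//; last exact: inth.
  apply/andP; split.
    rewrite -[X in (_ - X)%R]mul1r -Rintegral_cst// -RintegralB//.
    apply: le_Rintegral => //; last by move=> x _; case/andP: (hg x).
    exact: (integrableB measurableT iMh i1).
  by apply: le_Rintegral => // x _; case/andP: (hg x).
have KM : (K <= M%:R * e)%R.
  by rewrite -ler_pdivrMr// ltW// truncnS_gt.
have n0 : (0 <= fine (nu setT))%R by exact: fine_ge0.
have m0 : (0 <= fine (mu setT))%R by exact: fine_ge0.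
(* After multiplication by [M], the layer cake sums differ by at most M s, and rounding adds at most
   K <= M e. *)
rewrite -(ler_pM2l M0) -{1}(gtr0_norm M0) -normrM mulrBr mulrDr ler_norml.
have /andP[mu1 mu2] := err mu; have /andP[nu1 nu2] := err nu.
move: (gs M) KM; rewrite /K ler_norml => /andP[gs1 gs2] KM.
by apply/andP; split; lra.
Qed.

(** With h = (f + c)/(2c) in [0, 1], f = 2c h - c. The part 2c h contributes 2c s, and the constant
    contributes c s through the total masses, whence the factor 3c. *)
Lemma integral_diff_le (f : T -> R) (c : R) (s : \bar R) : (0 < c)%R ->
  (forall A, measurable A -> `|mu A - nu A| <= s) ->
  measurable_fun setT f -> (forall x, `|f x| <= c)%R ->
  `|\int[mu]_x (f x)%:E - \int[nu]_x (f x)%:E| <= (3 * c)%:E * s.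
Proof.
(* For s = +oo the right side is +oo as 3c > 0; s = -oo contradicts the nonnegativity of the
   absolute value at the empty set. *)
move=> c0; case: s => [s| |] mus mf fc; last 2 first.
- by rewrite gt0_muley ?leey// lte_fin mulr_gt0.
- by have := le_trans (abse_ge0 _) (mus _ measurable0).
have intf (mu0 : {finite_measure set T -> \bar R}) :
  mu0.-integrable setT (EFin \o f) by exact: bounded_integrable mf fc.
pose h x := ((2 * c)^-1 * (f x + c))%R.
have mh : measurable_fun setT h.
  by apply: measurable_funM => //; exact: measurable_funD.
have h01 x : (0 <= h x <= 1)%R.
  have := fc x; rewrite ler_norml => /andP[f1 f2].
  rewrite /h mulrC ler_pdivlMr ?ler_pdivrMr ?mulr_gt0//.
  by apply/andP; split; lra.
have hE (mu0 : {finite_measure set T -> \bar R}) :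
    (\int[mu0]_x f x = 2 * c * \int[mu0]_x h x - c * fine (mu0 setT))%R.
  have ic : mu0.-integrable setT (EFin \o cst c).
    exact: finite_measure_integrable_cst.
  rewrite /h RintegralZl//; last exact: (integrableD measurableT (intf mu0) ic).
  rewrite (RintegralD measurableT (intf mu0) ic) Rintegral_cst//.
  rewrite mulrA divff ?mul1r ?addrK//.
  by rewrite mulf_neq0// gt_eqF.
have := mus _ measurableT.
rewrite -(fineK (fin_num_measure mu _ measurableT)).
rewrite -(fineK (fin_num_measure nu _ measurableT)).
have RE (mu0 : {finite_measure set T -> \bar R}) :
    \int[mu0]_x (f x)%:E = (\int[mu0]_x f x)%:E.
  by rewrite fineK//; exact: integrable_fin_num (intf mu0).
rewrite !RE -!EFinB !abse_EFin -EFinM !lee_fin => musT.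
have hs := integral01_diff_le mus mh h01.
rewrite !hE.
have -> : (2 * c * \int[mu]_x h x - c * fine (mu setT) -
  (2 * c * \int[nu]_x h x - c * fine (nu setT)) =
  2 * c * (\int[mu]_x h x - \int[nu]_x h x) -
  c * (fine (mu setT) - fine (nu setT)))%R by lra.
apply: le_trans (ler_normB _ _) _; rewrite !normrM (gtr0_norm c0) normr_nat.
have -> : (3 * c * s = 2 * c * s + c * s)%R by lra.
by apply: lerD; rewrite ler_wpM2l// ?mulr_ge0// ltW.
Qed.

End finite_measure_difference.

(** * Differences of two Borel measures: enlarging the class of test sets and functions *)

Section borel_measure_difference.
Context {R : realType} {X : pmetricType R}.
Variables mu nu : borel_finite_measure R X.
Local Open Scope ereal_scope.

Lemma M_normP (f : X -> R) (c : R) : M_ X c f <->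
  measurable_fun [set: borel X] (f : borel X -> R) /\ forall x, (`|f x| <= c)%R.
Proof.
by split=> -[mf fc]; split => // x; have := fc x; rewrite in_itv/= ler_norml.
Qed.

(** Outer approximations [U] for [mu] and [V] for [nu] are intersected, which gives one open set
    within e of [A] for both measures. *)
Lemma measure_diff_borel_le (s : \bar R) :
  (forall U : set X, open U -> `|mu U - nu U| <= s) ->
  forall A : set (borel X), measurable A -> `|mu A - nu A| <= s.
Proof.
move=> Us A mA; apply/lee_addgt0Pr => e e0.
have [U [oU AU Ue]] := @borel_outer_regular _ _ mu A mA _ e0.
have [V [oV AV Ve]] := @borel_outer_regular _ _ nu A mA _ e0.
have oW : open (U `&` V) by exact: openI.
have mW : measurable (U `&` V : set (borel X)) by exact: open_borel.
have AW : A `<=` U `&` V by move=> x Ax; split; [exact: AU|exact: AV].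
(* [W] stands for [U] or [V]: the intersection lies between [A] and [W], whose measure exceeds that
   of [A] by at most e. *)
have split_measure (mu0 : borel_finite_measure R X) (W : set X) :
    open W -> U `&` V `<=` W -> mu0 (W `\` A) <= e%:E ->
    (fine (mu0 A) <= fine (mu0 (U `&` V)) <= fine (mu0 A) + e)%R.
  move=> oO UVW We; have mO := open_borel oO.
  have mOA : measurable (W `\` A : set (borel X)) by exact: measurableD.
  rewrite -!lee_fin EFinD !fineK ?fin_num_measure//; apply/andP; split.
    by apply: le_measure; rewrite ?inE.
  apply: le_trans (leeD2l _ We); rewrite -measureU//; last first.
    by rewrite setDE setICA setICr setI0.
  apply: le_measure; rewrite ?inE//; first exact: measurableU.
  move=> x Wx; have [Ax|nAx] := pselect (A x); [by left|right].
  by split => //; exact: UVW.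
have := split_measure mu U oU (@subIsetl _ _ _) Ue.
have := split_measure nu V oV (@subIsetr _ _ _) Ve.
have := Us _ oW; case: s {Us} => [s| |]; last 2 first.
- by rewrite !leey.
- by move=> /(le_trans (abse_ge0 _)).
rewrite -(fineK (fin_num_measure mu _ mW)) -(fineK (fin_num_measure nu _ mW)).
rewrite -(fineK (fin_num_measure mu _ mA)) -(fineK (fin_num_measure nu _ mA)).
rewrite -!EFinB !abse_EFin -EFinD !lee_fin !ler_norml.
by move=> /andP[? ?] /andP[? ?] /andP[? ?]; apply/andP; split; lra.
Qed.

(** The closed sets of points at capped distance at least 1/(n+1) from the complement increase to
    [U] and inherit its boundedness. If [U] is the whole space, the cap makes each of them [U]. *)
Lemma measure_diff_open_bounded_le (s : \bar R) :
  (forall A : set X, closed A -> metric_bounded A -> `|mu A - nu A| <= s) ->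
  forall U : set X, open U -> metric_bounded U -> `|mu U - nu U| <= s.
Proof.
move=> As U oU bU.
pose F n := [set x : X | (n.+1%:R^-1 <= cdist (~` U) x)%R].
have cF n : closed (F n).
  have /continuous_closedP := mlipschitz_continuous (mlipschitz_cdist (~` U)).
  by move=> /(_ [set t | n.+1%:R^-1 <= t]%R); apply; exact: closed_ge.
have FU n : F n `<=` U.
  move=> x Fx; apply: contrapT => /(@cdist_eq0 _ _ (~` U)) x0.
  by move: Fx; rewrite /F/= x0 leNgt invr_gt0 ltr0n.
have -> : U = \bigcup_n F n.
  apply/seteqP; split => x; last by move=> [n _ /FU].
  move=> Ux; have /cdist_gt0 d0 : closed (~` U) by exact: open_closedC.
  have {}d0 := d0 x (fun nUx => nUx Ux).
  exists (Num.trunc (cdist (~` U) x)^-1) => //; rewrite /F/=.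
  by rewrite invf_ple ?posrE// ltW// truncnS_gt.
apply: measure_diff_bigcup_le.
- by move=> n; exact: closed_borel.
- move=> m n mn; rewrite subsetEset => x; apply: le_trans.
  by rewrite lef_pV2 ?posrE// ler_nat.
- move=> n; apply: As => //; case: bU => x [r Ur]; exists x, r.
  exact: subset_trans Ur.
Qed.

Lemma measure_diff_open_le (s : \bar R) :
  (forall U : set X, open U -> metric_bounded U -> `|mu U - nu U| <= s) ->
  forall U : set X, open U -> `|mu U - nu U| <= s.
Proof.
move=> Us U oU; pose B n := [set x : X | (mdist point x < n%:R)%R].
have oB n : open (B n).
  have /continuousP := mlipschitz_continuous (mlipschitz_mdist (point : X)).
  by move=> /(_ [set t | t < n%:R]%R); apply; exact: open_lt.
have -> : U = \bigcup_n (U `&` B n).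
  apply/seteqP; split => x; last by move=> [n _ []].
  move=> Ux; exists (Num.trunc (mdist point x)).+1 => //; split => //.
  exact: truncnS_gt.
apply: measure_diff_bigcup_le.
- by move=> n; apply: open_borel; exact: openI.
- move=> m n mn; rewrite subsetEset; apply: setIS => x /lt_le_trans; apply.
  by rewrite ler_nat.
- move=> n; apply: Us; first exact: openI.
  by exists point, n%:R => x [_]; rewrite ballEmdist.
Qed.

Lemma measure_diff_unif_continuous_le (s : \bar R) :
  (forall f : X -> R, continuous f -> M_ X 1 f -> unif_continuous f ->
    `|\int[mu]_x (f x)%:E - \int[nu]_x (f x)%:E| <= s) ->
  forall U : set X, open U -> `|mu U - nu U| <= s.
Proof.
move=> fs U oU; pose f n := clamp \o (fun x => n%:R * cdist (~` U) x)%R.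
have lf n : mlipschitz n%:R (f n).
  apply: mlipschitz_clamp => x y; rewrite -mulrBr normrM normr_nat.
  by rewrite ler_wpM2l// -[leRHS]mul1r; exact: mlipschitz_cdist.
have f1 n x : (`|f n x| <= 1)%R by rewrite ger0_norm ?clamp_ge0 ?clamp_le1.
have cf n := mlipschitz_continuous (lf n).
have mU := open_borel oU.
rewrite -(setIT U) -!integral_indic//.
apply: (@integral_diff_cvg_le _ _ _ mu nu f _ 1%R) => //.
- by move=> n; exact: continuous_borel.
- move=> x; rewrite indicE; have [|] := boolP (x \in U); rewrite ?inE => Ux.
    have /cdist_gt0 d0 : closed (~` U) by exact: open_closedC.
    have {}d0 := d0 x (fun nUx => nUx Ux).
    apply: cvg_near_cst; near=> n; apply: clamp_id_ge1.
    rewrite -ler_pdivrMr// div1r; near: n; exact: nbhs_infty_ger.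
  rewrite notin_setE in Ux; apply: cvg_near_cst; near=> n.
  by rewrite /f/= cdist_eq0// mulr0 clamp_id_le0.
- move=> n; apply: fs => //; last exact: mlipschitz_unif_continuous (lf n).
  by apply/M_normP; split => //; exact: continuous_borel.
Unshelve. all: by end_near. Qed.

(** The cutoff [k n] is 1 up to distance n - 1 from [point] and 0 from distance n on. Its product
    with [f] has bounded support, keeps the bound [c], and equals [f] at each given point for large
    n. *)
Lemma integral_diff_bounded_support_le (c : R) (s : \bar R) :
  (forall f : X -> R, continuous f -> M_ X c f -> metric_bounded (tsupport f) ->
    `|\int[mu]_x (f x)%:E - \int[nu]_x (f x)%:E| <= s) ->
  forall f : X -> R, continuous f -> M_ X c f ->
    `|\int[mu]_x (f x)%:E - \int[nu]_x (f x)%:E| <= s.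
Proof.
move=> fs f cf /M_normP[mf fc].
pose k n (x : X) : R := clamp (n%:R - mdist point x).
have lk n : mlipschitz 1 (k n).
  apply: mlipschitz_clamp => x y.
  by rewrite opprB addrC addrA subrK distrC; exact: mlipschitz_mdist.
have ck n : continuous (k n) := mlipschitz_continuous (lk n).
pose g n x : R := (f x * k n x)%R.
have cg n : continuous (g n) by move=> x; apply: cvgM; [exact: cf|exact: ck].
have gc n x : (`|g n x| <= c)%R.
  rewrite normrM; apply: le_trans (fc x); rewrite ler_piMr//.
  by rewrite ger0_norm ?clamp_ge0 ?clamp_le1.
apply: (@integral_diff_cvg_le _ _ _ mu nu g _ c) => //.
- by move=> n; exact: continuous_borel.
- move=> x; apply: cvg_near_cst; near=> n.
  rewrite /g /k clamp_id_ge1 ?mulr1// lerBrDr addrC -lerBrDr -lerBlDr.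
  near: n; exact: nbhs_infty_ger.
- move=> n; apply: fs => //.
    by apply/M_normP; split => //; exact: continuous_borel.
  (* The support lies in the closed ball of radius n, hence in the open ball of radius n + 1. *)
  exists point, (n%:R + 1)%R.
  have cB : closed [set x : X | (mdist point x <= n%:R)%R].
    have /continuous_closedP :=
      mlipschitz_continuous (mlipschitz_mdist (point : X)).
    by move=> /(_ [set t | t <= n%:R]%R); apply; exact: closed_le.
  have gB : [set x | g n x != 0%R] `<=` [set x : X | (mdist point x <= n%:R)%R].
    move=> x /=; apply: contraR; rewrite -ltNge => nx.
    by rewrite /g /k clamp_id_le0 ?mulr0// subr_le0 ltW.
  move=> x /(closureS gB); rewrite -(closure_id _).1// ballEmdist/= => xn.
  by rewrite (le_lt_trans xn)// ltrDl.
Unshelve. all: by end_near. Qed.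

End borel_measure_difference.

(** * Suprema tending to 0, and the cycle of implications *)

(** Squeeze between 0 and c times the first supremum. The estimate is asked for every upper bound
    [s] at a fixed n, the form in which the bounds above are proved. *)
Lemma cvg_ereal_sup0 (R : realType) (I J : Type) (F : nat -> I -> \bar R)
    (G : nat -> J -> \bar R) (S : set I) (S' : set J) (c : R) :
  0 < c -> S' !=set0 -> (forall n j, 0 <= G n j)%E ->
  (forall n s, (forall i, S i -> (F n i <= s)%E) ->
    forall j, S' j -> (G n j <= c%:E * s)%E) ->
  ereal_sup [set F n i | i in S] @[n --> \oo] --> 0%E ->
  ereal_sup [set G n j | j in S'] @[n --> \oo] --> 0%E.
Proof.
move=> c0 [j0 Sj0] G0 FG supF.
apply: (@squeeze_cvge _ _ _ _ (cst 0%E) _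
  (fun n => c%:E * ereal_sup [set F n i | i in S])%E).
- apply: nearW => n; apply/andP; split.
    (* The member [j0] keeps the supremum from being -oo, so it is at least 0. *)
    by apply: (le_trans (G0 n j0)); apply: ereal_sup_ubound; exists j0.
  apply: ge_ereal_sup => _ [j Sj <-]; apply: FG => // i Si.
  by apply: ereal_sup_ubound; exists i.
- exact: cvg_cst.
- by rewrite -[X in _ --> X](mule0 c%:E); apply: cvgeZl.
Qed.

Theorem theorem2p12 (R : realType) (X : pmetricType R)
    (nu_ : nat -> borel_finite_measure R X) (nu : borel_finite_measure R X) :
  [<-> (* I *)
       cvg_total_variation nu_ nu;
       (* II *)
       sup_measure_cvg0 nu_ nu [set A | closed A /\ metric_bounded A];
       (* III *)
       sup_measure_cvg0 nu_ nu [set B | open B /\ metric_bounded B];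
       (* IV *)
       forall gamma : R, 0 <= gamma ->
         sup_integral_cvg0 nu_ nu (M_ X gamma);
       (* V *)
       forall gamma : R, 0 <= gamma ->
         sup_integral_cvg0 nu_ nu
           [set f | M_ X gamma f /\ metric_bounded (tsupport f)];
       (* VI *)
       forall gamma : R, 0 <= gamma ->
         sup_integral_cvg0 nu_ nu
           [set f | [/\ continuous f, M_ X gamma f &
                        metric_bounded (tsupport f)]];
       (* VII *)
       forall gamma : R, 0 <= gamma ->
         sup_integral_cvg0 nu_ nu
           [set f | [/\ continuous f, M_ X gamma f & unif_continuous f]]].
Proof.
have bounded0 : metric_bounded (set0 : set X) by exists point, 0.
have M0 (c : R) : 0 <= c -> M_ X c (cst 0).
  by move=> c0; apply/M_normP; split => // x; rewrite normr0.
have supp0 : metric_bounded (tsupport (cst 0 : X -> R)).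
  rewrite /tsupport (_ : [set x | _] = set0) ?closure0//.
  by apply/seteqP; split => x //=; rewrite eqxx.
tfae.
(* (I) to (II): the indicator of a closed set belongs to [M_ X 1]. *)
- apply: (cvg_ereal_sup0 ltr01).
  + by exists set0; split => //; exact: closed0.
  + by move=> n A; exact: abse_ge0.
  + move=> n s fs A [cA _]; rewrite mul1e.
    have mA := closed_borel cA.
    rewrite -(setIT A) -!integral_indic//; apply: fs.
    apply/M_normP; split; first exact: measurable_indic.
    move=> x; rewrite indicE.
    by case: (_ \in _); rewrite ?normr0 ?normr1 ?ler01.
- apply: (cvg_ereal_sup0 ltr01).
  + by exists set0; split => //; exact: open0.
  + by move=> n A; exact: abse_ge0.
  + move=> n s As B [oB bB]; rewrite mul1e.
    by apply: measure_diff_open_bounded_le => // A cA bA; exact: As.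
(* (III) to (IV): [c] may be 0, so [c + 1] serves as the positive bound in [integral_diff_le]. *)
- move=> h c c0; have c1 : 0 < 3 * (c + 1) by rewrite mulr_gt0// ltr_wpDl.
  apply: (cvg_ereal_sup0 c1) h.
  + by exists (cst 0); exact: M0.
  + by move=> n f; exact: abse_ge0.
  + move=> n s Us f /M_normP[mf fc]; apply: integral_diff_le => //.
    * by rewrite ltr_wpDl.
    * apply: measure_diff_borel_le; apply: measure_diff_open_le => U oU bU.
      exact: Us.
    * by move=> x; rewrite (le_trans (fc x))// lerDl.
(* (IV) to (V), and next (V) to (VI): the family shrinks. *)
- move=> h c c0; apply: (cvg_ereal_sup0 ltr01) (h c c0).
  + by exists (cst 0); split => //; exact: M0.
  + by move=> n f; exact: abse_ge0.
  + by move=> n s fs f [Mf _]; rewrite mul1e; exact: fs.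
- move=> h c c0; apply: (cvg_ereal_sup0 ltr01) (h c c0).
  + by exists (cst 0); split => //; [exact: cst_continuous|exact: M0].
  + by move=> n f; exact: abse_ge0.
  + by move=> n s fs f [_ Mf bf]; rewrite mul1e; exact: fs.
(* (VI) to (VII): cutoffs remove the bounded support. *)
- move=> h c c0; apply: (cvg_ereal_sup0 ltr01) (h c c0).
  + exists (cst 0); split; [exact: cst_continuous|exact: M0|].
    apply: (@mlipschitz_unif_continuous _ _ 0) => x y.
    by rewrite subrr normr0 mul0r.
  + by move=> n f; exact: abse_ge0.
  + move=> n s fs f [cf Mf _]; rewrite mul1e.
    by apply: integral_diff_bounded_support_le Mf => // g cg Mg bg; exact: fs.
(* (VII) to (I): taken at gamma = 1, with the factor 3 from [integral_diff_le]. *)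
- move=> h; apply: (cvg_ereal_sup0 _ _ _ _ (h 1 ler01)).
  + exact: (_ : 0 < 3 * 1).
  + by exists (cst 0); exact: M0.
  + by move=> n f; exact: abse_ge0.
  + move=> n s fs f /M_normP[mf f1]; apply: integral_diff_le => //.
    apply: measure_diff_borel_le; apply: measure_diff_unif_continuous_le.
    by move=> g cg Mg ug; exact: fs.
Qed.
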